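(* Let $\psi\in C^1(\mathbb{R})$ satisfy: $\psi(0)=1$, $\psi$ is even, there exist $C>0$ and $\delta>1$ with $|\psi(x)|+|x\psi'(x)|\leq C\langle x\rangle^{-\delta}$ for all $x\in\mathbb{R}$, and $A_\psi:=\int_{\mathbb{R}}\psi(x)\,\mathrm{d}x\neq 0$. Let $h(x)=\psi(x)+x\psi'(x)$ and let $\mu$ be a probability measure on $\mathbb{R}$. Then for $b\in\mathbb{R}$: 1. $\lim_{\varepsilon\downarrow0}\varepsilon\int_\varepsilon^\infty W_h(\mu)(b,a)\frac{\mathrm{d}a}{a}=\mu(\{b\})$. 2. Let $0<\alpha\leq1$ and assume that $(d_\alpha\mu)(b)$ exists. Then $\lim_{\varepsilon\downarrow0}\varepsilon^{1-\alpha}\int_\varepsilon^\infty W_h(\mu)(b,a)\frac{\mathrm{d}a}{a}=c_\alpha(d_\alpha\mu)(b)$, where $c_\alpha=\int_0^\infty\alpha2^\alpha y^{\alpha-1}\psi(y)\,\mathrm{d}y$.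
   Context: $\langle x\rangle=(1+x^2)^{1/2}$. The continuous wavelet transform of $\mu$ is $W_h(\mu)(b,a)=\frac1a\int_{-\infty}^{\infty}h((b-y)/a)\,\mathrm{d}\mu(y)$ for $b\in\mathbb{R}$, $a>0$. For $0\leq\alpha\leq1$, $(d_\alpha\mu)(x)=\lim_{\varepsilon\downarrow0}\mu((x-\varepsilon,x+\varepsilon))/(2\varepsilon)^\alpha$ whenever this limit exists. *)

(* Defs.v *)
From HB Require Import structures.
From mathcomp Require Import all_boot all_order all_algebra.
From mathcomp Require Import all_classical all_reals all_analysis.
Set Implicit Arguments. Unset Strict Implicit. Unset Printing Implicit Defensive.
Import Order.TTheory GRing.Theory Num.Theory.
Import numFieldNormedType.Exports.
Local Open Scope classical_set_scope.
Local Open Scope ring_scope.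

Definition jbr {R : realType} (x : R) : R := Num.sqrt (1 + x ^+ 2).

Definition cwt {R : realType} (h : R -> R) (mu : probability R R) (b a : R) : R :=
  a^-1 * Rintegral mu setT (fun y => h ((b - y) / a)).

Definition dalpha_is {R : realType} (mu : probability R R) (alpha x L : R) : Prop :=
  (fun eps : R => fine (mu [set` `]x - eps, x + eps[]) / ((2 * eps) `^ alpha))
     @ 0^'+ --> L.

(* Main.v *)
Require Import Defs.
From HB Require Import structures.
From mathcomp Require Import all_boot all_order all_algebra.
From mathcomp Require Import all_classical all_reals all_analysis.
From mathcomp Require Import measurable_realfun ring lra.
Import Order.TTheory GRing.Theory Num.Theory.
Import numFieldNormedType.Exports.
Local Open Scope classical_set_scope.
Local Open Scope ring_scope.

(** Since [- psi (u / a) / a] is a primitive in [a] of [a^-2 h (u / a)], Fubini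
    gives [\int_e^oo W_h(mu)(b, a) da / a = e^-1 \int psi ((b - y) / e) dmu(y)].
    Multiplied by [e], this tends to [psi 0 * mu {b}] by dominated convergence.
    For part 2, writing the even function [psi x] as [- \int_(s > |x|) psi' s ds]
    turns [\int psi ((b - y) / e) dmu(y)] into [- \int_0^oo psi' s M(e s) ds] with
    [M r = mu ]b - r, b + r[].  As [M r / (2 r)^alpha] is bounded and tends to
    [L], dominated convergence gives the limit [- L \int_0^oo psi' s (2 s)^alpha ds],
    which is [c_alpha L] after an integration by parts. *)

(** * Integrals of derivatives along exhausting segments *)

Definition exhausts {R : realType} (D : set R) (u v : R^nat) : Prop :=
  [/\ forall n, u n < v n, forall n, `[u n, v n] `<=` D &
      forall x, D x -> \forall n \near \oo, x \in `[u n, v n]].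

Section Exhaustion.
Context {R : realType} (D : set R) (f F : R -> R) (u v : R^nat).
Local Notation leb := (@lebesgue_measure R).

Lemma continuous_measurable_on : measurable D ->
  (forall x, D x -> {for x, continuous f}) -> measurable_fun D f.
Proof.
move=> mD cf; apply: (subspace_continuous_measurable_fun mD).
by apply: continuous_in_subspaceT => x /set_mem; exact: cf.
Qed.

(** The segment enters through an indicator while the domain stays [D] for every n: Fatou and
    dominated convergence need a fixed domain. The truncations converge pointwise because each point
    of [D] eventually lies in the segments. *)
Lemma integral_segment_FTC2 n : exhausts D u v ->
  (forall x, D x -> {for x, continuous f}) ->
  (forall x, D x -> is_derive x 1 F (f x)) ->
  (\int[leb]_(x in D) ((f x)%:E * (\1_(`[u n, v n]) x)%:E) =
   (F (v n) - F (u n))%:E)%E.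
Proof.
move=> [uv sD _] cf dF.
transitivity (\int[leb]_(x in `[u n, v n]) (f x)%:E)%E; last first.
  rewrite EFinB; apply: continuous_FTC2 => //.
  - by apply: continuous_in_subspaceT => x /set_mem /sD; exact: cf.
  - have cF x : D x -> {for x, continuous F}.
      by move=> Dx; have := dF _ Dx => -[/derivable1_diffP /differentiable_continuous].
    split => /=.
    + by move=> x /subset_itv_oo_cc /sD /dF [].
    + apply: cvg_at_right_filter; apply: cF; apply: (sD n).
      by rewrite /= in_itv/= lexx ltW.
    + apply: cvg_at_left_filter; apply: cF; apply: (sD n).
      by rewrite /= in_itv/= lexx ltW.
  - by move=> x /subset_itv_oo_cc /sD /dF dx; rewrite derive1E derive_val.
rewrite -[in LHS](setIidr (sD n)).
rewrite [RHS]integral_mkcond [LHS]integral_mkcond.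
apply: eq_integral => x _; rewrite !patchE indicE.
rewrite in_setI; case: (boolP (x \in `[u n, v n]%classic)) => [xuv|_] /=.
  by have /sD /mem_set xD := set_mem xuv; rewrite xD mule1.
by rewrite andbF mule0 if_same.
Qed.

Lemma near_exhausts_indic x : exhausts D u v -> D x ->
  \forall n \near \oo, ((f x)%:E * (\1_(`[u n, v n]) x)%:E)%E = (f x)%:E.
Proof.
move=> [_ _ uvD] /uvD; apply: filterS => n xuv.
by rewrite indicE mem_set// mule1.
Qed.

Lemma measurable_exhausts_indic n : measurable D ->
  (forall x, D x -> {for x, continuous f}) ->
  measurable_fun D (fun x => ((f x)%:E * (\1_(`[u n, v n]) x)%:E)%E).
Proof.
move=> mD cf; apply/measurable_EFinP; apply: measurable_funM.
  exact: continuous_measurable_on.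
by apply: measurable_indic.
Qed.

(** By Fatou, the integral of f is at most the limit of the truncated integrals F (v n) - F (u n),
    that is m - l, hence finite. *)
Lemma ge0_integrable_primitive (l m : R) : measurable D -> exhausts D u v ->
  (forall x, D x -> {for x, continuous f}) ->
  (forall x, D x -> is_derive x 1 F (f x)) ->
  (forall x, D x -> 0 <= f x) ->
  F (u n) @[n --> \oo] --> l -> F (v n) @[n --> \oo] --> m ->
  leb.-integrable D (EFin \o f).
Proof.
move=> mD uvD cf dF f0 Ful Fvm.
have mf := continuous_measurable_on mD cf.
apply/integrableP; split; first exact/measurable_EFinP.
pose g n x := ((f x)%:E * (\1_(`[u n, v n]) x)%:E)%E.
have g0 n x : D x -> (0 <= g n x)%E.
  by move=> Dx; rewrite mule_ge0// lee_fin// f0.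
have := fatou leb mD (fun n => measurable_exhausts_indic n mD cf) g0.
have limF : (\int[leb]_(x in D) g n x)%E @[n --> \oo] --> (m - l)%:E.
  under eq_fun do rewrite (integral_segment_FTC2 _ uvD cf dF).
  by apply: cvg_EFin; [exact: nearW | exact: cvgB].
rewrite is_cvg_limn_einfE; last by apply/cvg_ex; exists (m - l)%:E.
rewrite (cvg_lim _ limF)//; move=> /le_lt_trans/(_ (ltry _)).
apply: le_lt_trans; rewrite le_eqVlt; apply/orP; left; apply/eqP.
apply: eq_integral => x /set_mem Dx /=.
have gx : g n x @[n --> \oo] --> (f x)%:E.
  by apply: cvg_near_cst; exact: near_exhausts_indic.
rewrite is_cvg_limn_einfE; last by apply/cvg_ex; exists (f x)%:E.
by rewrite (cvg_lim _ gx)// ger0_norm// f0.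
Qed.

(** Here f may change sign, so Fatou is replaced by dominated convergence: the truncations are
    dominated by |f|, and their integrals tend both to the integral of f and to m - l. *)
Lemma Rintegral_primitive (l m : R) : measurable D -> exhausts D u v ->
  (forall x, D x -> {for x, continuous f}) ->
  (forall x, D x -> is_derive x 1 F (f x)) ->
  leb.-integrable D (EFin \o f) ->
  F (u n) @[n --> \oo] --> l -> F (v n) @[n --> \oo] --> m ->
  \int[leb]_(x in D) f x = m - l.
Proof.
move=> mD uvD cf dF fi Ful Fvm.
pose g n x := ((f x)%:E * (\1_(`[u n, v n]) x)%:E)%E.
have limF : (\int[leb]_(x in D) g n x)%E @[n --> \oo] --> (m - l)%:E.
  under eq_fun do rewrite (integral_segment_FTC2 _ uvD cf dF).
  by apply: cvg_EFin; [exact: nearW | exact: cvgB].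
have gx x : D x -> g n x @[n --> \oo] --> (f x)%:E.
  by move=> Dx; apply: cvg_near_cst; exact: near_exhausts_indic.
rewrite /Rintegral -[RHS]/(fine (m - l)%:E); congr fine.
apply: cvg_unique limF => //; apply: cvg_trans; last first.
  apply: (@dominated_cvg _ _ _ leb D mD g (EFin \o f) (abse \o EFin \o f)) => //.
  - by move=> n; exact: measurable_exhausts_indic.
  - exact: integrable_abse.
  - move=> n x Dx; rewrite /g /= lee_fin normrM ler_piMr//.
    by rewrite indicE; case: (_ \in _); rewrite ?normr1 ?normr0.
exact: cvg_id.
Qed.

End Exhaustion.

(** * Exhausting sequences for half-lines and for the unit interval *)

Lemma cvg_addn_pinfty {R : realType} (c : R) : c + n.+1%:R @[n --> \oo] --> +oo.
Proof.
apply/cvgryPge => A; near=> n; rewrite -lerBlDl (@le_trans _ _ n%:R)// ?ler_nat//.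
by near: n; exact: nbhs_infty_ger.
Unshelve. all: by end_near. Qed.

Lemma cvg_addn_inv {R : realType} (c : R) : c + n.+2%:R^-1 @[n --> \oo] --> c.
Proof.
rewrite -[X in _ --> X]addr0; apply: cvgD; first exact: cvg_cst.
apply/gtr0_cvgV0; first exact: nearW.
apply/cvgryPge => A; near=> n; rewrite (@le_trans _ _ n%:R)// ?ler_nat 1?ltnW//.
by near: n; exact: nbhs_infty_ger.
Unshelve. all: by end_near. Qed.

Lemma exhausts_itvcy {R : realType} (c : R) :
  exhausts `[c, +oo[ (fun=> c) (fun n => c + n.+1%:R).
Proof.
split=> [n|n x|x]; first by rewrite ltrDl.
  by rewrite /= !in_itv/= andbT => /andP[].
rewrite /= in_itv/= andbT => cx; near=> n; rewrite in_itv/= cx /=.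
by near: n; have /cvgryPge := cvg_addn_pinfty c; exact.
Unshelve. all: by end_near. Qed.

(** The shift to n + 2 gives 1 / (n + 2) < 1 <= n + 1, so the segment is non-degenerate already at n
    = 0. *)
Lemma exhausts_itvoy {R : realType} (c : R) :
  exhausts `]c, +oo[ (fun n => c + n.+2%:R^-1) (fun n => c + n.+1%:R).
Proof.
split=> [n|n x|x].
- rewrite ltrD2l (@lt_le_trans _ _ 1)//; first by rewrite invf_lt1// ltr1n.
  by rewrite ler1n.
- rewrite /= !in_itv/= andbT => /andP[+ _]; apply: lt_le_trans.
  by rewrite ltrDl invr_gt0.
- rewrite /= in_itv/= andbT => cx; near=> n; rewrite in_itv/=; apply/andP; split.
    by near: n; have /cvgr_le := cvg_addn_inv c; exact.
  by near: n; have /cvgryPge := cvg_addn_pinfty c; exact.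
Unshelve. all: by end_near. Qed.

Lemma exhausts_itv01 {R : realType} :
  exhausts (`]0, 1] : set R) (fun n => 0 + n.+2%:R^-1) (fun=> 1).
Proof.
split=> [n|n x|x].
- by rewrite add0r invf_lt1// ltr1n.
- rewrite /= !in_itv/= => /andP[nx ->]; rewrite andbT.
  by rewrite (lt_le_trans _ nx)// add0r invr_gt0.
- rewrite /= in_itv/= => /andP[x0 x1]; near=> n; rewrite in_itv/= x1 andbT.
  by near: n; have /cvgr_le := cvg_addn_inv (0 : R); exact.
Unshelve. all: by end_near. Qed.

(** * Power functions: limits, primitives, integrability *)

Lemma continuous_powR_pos {R : realType} (p x : R) : 0 < x ->
  {for x, continuous (@powR R ^~ p)}.
Proof.
move=> x0; apply: differentiable_continuous; apply/derivable1_diffP.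
by apply: derivable_powR; rewrite in_itv/= andbT.
Qed.

(** Writing v^p as (1 / v)^(-p) with -p > 0 turns the limit at infinity into the limit of a positive
    power at 0 from the right. *)
Lemma powR_lt0_cvg0 {R : realType} (v : R^nat) (p : R) : p < 0 ->
  (forall n, 0 < v n) -> v n @[n --> \oo] --> +oo ->
  v n `^ p @[n --> \oo] --> 0.
Proof.
move=> p0 v0 vy.
under eq_fun => n do rewrite -[v n]invrK -powR_inv1 ?invr_ge0 ?ltW// -powRrM mulN1r.
have : (v n)^-1 @[n --> \oo] --> 0 by apply/gtr0_cvgV0 => //; exact: nearW.
move=> vV0; have /cvg_at_rightP : a `^ (- p) @[a --> (0:R)^'+] --> 0.
  by apply: powR_cvg0; rewrite oppr_gt0.
by apply; split => // n; rewrite invr_gt0.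
Qed.

Lemma is_derive_powR_primitive {R : realType} (p x : R) : p + 1 != 0 -> 0 < x ->
  is_derive x 1 (fun y : R => (p + 1)^-1 * y `^ (p + 1)) (x `^ p).
Proof.
move=> p1 x0; pose D := is_derive1_powR (p + 1) x0.
apply: (@is_derive_eq _ _ _ _ _ _ _ _ (is_deriveZ (p + 1)^-1 D)).
by rewrite addrK /GRing.scale /= mulrA mulVf// mul1r.
Qed.

Lemma integrable_powR01 {R : realType} (p : R) : -1 < p ->
  (@lebesgue_measure R).-integrable `]0, 1] (fun x => (x `^ p)%:E).
Proof.
move=> p0; have p1 : 0 < p + 1 by lra.
have pos (x : R) : `]0, 1]%classic x -> 0 < x by rewrite /= in_itv/= => /andP[].
apply: (@ge0_integrable_primitive _ _ _ (fun y => (p + 1)^-1 * y `^ (p + 1))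
  _ _ 0 ((p + 1)^-1) _ exhausts_itv01) => //.
- by move=> x /pos; exact: continuous_powR_pos.
- by move=> x /pos; apply: is_derive_powR_primitive; rewrite gt_eqF.
- by move=> x _; exact: powR_ge0.
- rewrite -[X in _ --> X](mulr0 (p + 1)^-1); apply: cvgMr.
  have /cvg_at_rightP : a `^ (p + 1) @[a --> (0:R)^'+] --> 0 by exact: powR_cvg0.
  apply; split=> [n|]; first by rewrite add0r invr_gt0.
  exact: cvg_addn_inv.
- by rewrite powR1 mulr1; exact: cvg_cst.
Qed.

Lemma integrable_powR_pinfty {R : realType} (c p : R) : 0 < c -> p < -1 ->
  (@lebesgue_measure R).-integrable `[c, +oo[ (fun x => (x `^ p)%:E).
Proof.
move=> c0 p0; have p1 : p + 1 < 0 by lra.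
have pos x : `[c, +oo[%classic x -> 0 < x.
  by rewrite /= in_itv/= andbT; exact: lt_le_trans.
apply: (@ge0_integrable_primitive _ _ _ (fun y => (p + 1)^-1 * y `^ (p + 1))
  _ _ ((p + 1)^-1 * c `^ (p + 1)) 0 _ (exhausts_itvcy c)) => //.
- by move=> x /pos; exact: continuous_powR_pos.
- by move=> x /pos; apply: is_derive_powR_primitive; rewrite lt_eqF.
- by move=> x _; exact: powR_ge0.
- exact: cvg_cst.
- rewrite -[X in _ --> X](mulr0 (p + 1)^-1); apply: cvgMr.
  apply: powR_lt0_cvg0 => // [n|]; first by rewrite addr_gt0.
  exact: cvg_addn_pinfty.
Qed.

(** * Fubini and dominated convergence for real-valued integrals *)

Section DominatedFubini.
Context d1 d2 (T1 : measurableType d1) (T2 : measurableType d2) {R : realType}.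
Variables (mu : probability T1 R) (nu : {sigma_finite_measure set T2 -> \bar R}).
Variables (D : set T2) (f : T1 -> T2 -> R) (k : T2 -> R).
Hypothesis mD : measurable D.
Hypothesis mf : measurable_fun setT (fun z : T1 * T2 => f z.1 z.2).
Hypothesis ik : nu.-integrable D (EFin \o k).
Hypothesis fk : forall y s, D s -> `|f y s| <= k s.

Let g (z : T1 * T2) : \bar R := (f z.1 z.2 * \1_D z.2)%:E.

Let mg : measurable_fun setT g.
Proof.
apply/measurable_EFinP; apply: measurable_funM => //.
by apply: (measurableT_comp (measurable_indic mD)); exact: measurable_snd.
Qed.

Let g_le y s : (`|g (y, s)| <= `|((EFin \o k) \_ D) s|)%E.
Proof.
rewrite /g /= patchE indicE; have [/set_mem Ds|] := boolP (s \in D) => /=.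
  by rewrite mulr1 lee_fin (le_trans (fk _ _ Ds))// ler_norm.
by rewrite mulr0 normr0.
Qed.

Let ikD : nu.-integrable setT ((EFin \o k) \_ D).
Proof. exact/(integrable_mkcond _ mD).1. Qed.

Let ig : (mu \x nu)%E.-integrable setT g.
Proof.
apply/integrable21ltyP => //.
have /integrableP[mk] := ikD; apply: le_lt_trans.
apply: ge0_le_integral => //.
- by move=> s _; exact: integral_ge0.
- apply: (measurable_fun_fubini_tonelli_G (abse \o g)) => //.
    exact: measurableT_comp.
  by move=> z; exact: abse_ge0.
- exact: measurableT_comp.
move=> s _.
(* The majorant does not depend on y and [mu] has total mass 1, so integrating it in y returns it
   unchanged. *)
apply: (@le_trans _ _ (\int[mu]_y `|((EFin \o k) \_ D) s|)%E).
  apply: ge0_le_integral => //.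
  apply: (measurableT_comp (@abse_measurable R setT)).
  by apply: (measurableT_comp mg); exact: measurable_pair2.
by rewrite integral_cst// [X in (_ * X)%E]probability_setT mule1.
Qed.

(** Fubini is applied to [g], which carries the restriction to [D] as an indicator. Integrability of
    both families of sections lets [fine] pass through the inner integrals. *)
Lemma Rintegral_Fubini_dominated :
  \int[mu]_y \int[nu]_(s in D) f y s = \int[nu]_(s in D) \int[mu]_y f y s.
Proof.
have fubini := Fubini ig.
have igs y : nu.-integrable D (EFin \o f y).
  apply: le_integrable ik => //.
    apply/measurable_EFinP/measurable_funTS.
    exact: (measurableT_comp mf (measurable_pair1 y)).
  by move=> s Ds; rewrite lee_fin (le_trans (fk y s Ds))// ler_norm.
have igy s : D s -> mu.-integrable setT (EFin \o f^~ s).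
  move=> Ds; apply: (@le_integrable _ _ _ _ setT _ _ (cst (k s)%:E)) => //.
  + apply/measurable_EFinP.
    exact: (measurableT_comp mf (measurable_pair2 s)).
  + by move=> y _; rewrite lee_fin (le_trans (fk y s Ds))// ler_norm.
  + exact: finite_measure_integrable_cst.
rewrite /Rintegral; congr fine.
transitivity (\int[mu]_y \int[nu]_s g (y, s))%E.
  apply: eq_integral => y _; rewrite (fineK (integrable_fin_num mD (igs y))).
  rewrite integral_mkcond; apply: eq_integral => s _.
  by rewrite /g /= patchE indicE; case: (s \in D); rewrite ?mulr1 ?mulr0.
rewrite fubini [RHS]integral_mkcond.
apply: eq_integral => s _; rewrite patchE /g /= indicE.
have [/set_mem Ds|_] := boolP (s \in D).
  rewrite (fineK (integrable_fin_num measurableT (igy s Ds))).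
  by apply: eq_integral => y _; rewrite mulr1.
by under eq_integral do rewrite mulr0; rewrite integral0.
Qed.

End DominatedFubini.

Section DominatedCvg.
Context d (T : measurableType d) {R : realType}.
Variables (mu : {measure set T -> \bar R}) (D : set T).

Lemma Rintegral_dominated_cvg (f : (T -> R)^nat) (g k : T -> R) :
  measurable D -> (forall n, measurable_fun D (f n)) ->
  (forall x, D x -> f n x @[n --> \oo] --> g x) ->
  mu.-integrable D (EFin \o k) ->
  (forall n x, D x -> `|f n x| <= k x) ->
  \int[mu]_(x in D) f n x @[n --> \oo] --> \int[mu]_(x in D) g x.
Proof.
move=> mD mf fg ik fk.
have mfE n : measurable_fun D (EFin \o f n) by exact/measurable_EFinP.
have fgE x : D x -> (EFin \o f n) x @[n --> \oo] --> (EFin \o g) x.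
  by move=> Dx; apply: cvg_EFin; [exact: nearW | exact: fg].
have fkE n x : D x -> (`|(EFin \o f n) x| <= (EFin \o k) x)%E.
  by move=> Dx; rewrite lee_fin fk.
have gE : mu.-integrable D (EFin \o g).
  apply: le_integrable ik => //.
    by apply: emeasurable_fun_cvg mfE fgE.
  move=> x Dx; rewrite lee_fin (@le_trans _ _ (k x)) ?ler_norm//.
  (* The bound by [k] survives the pointwise limit, so [g] is integrable and its integral is
     finite. *)
  have gx := fg x Dx.
  rewrite -(cvg_lim (@Rhausdorff R) (cvg_norm gx)).
  apply: limr_le; first by apply/cvg_ex; exists `|g x|; exact: cvg_norm.
  by apply: nearW => n; exact: fk.
apply: fine_cvg; rewrite (fineK (integrable_fin_num mD gE)).
exact: (dominated_cvg mD mfE fgE _ ik fkE).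
Qed.

End DominatedCvg.

Lemma integrable_itv0y {R : realType} (f k1 k2 : R -> R) :
  measurable_fun (`]0, +oo[ : set R) f ->
  (@lebesgue_measure R).-integrable `]0, 1] (EFin \o k1) ->
  (@lebesgue_measure R).-integrable `[1, +oo[ (EFin \o k2) ->
  (forall x : R, 0 < x <= 1 -> `|f x| <= k1 x) ->
  (forall x : R, 1 <= x -> `|f x| <= k2 x) ->
  (@lebesgue_measure R).-integrable `]0, +oo[ (EFin \o f).
Proof.
move=> mf i1 i2 f1 f2.
(* Both summands are present at x = 1; the absolute values make the sum a majorant there too. *)
pose g : R -> \bar R := (((abse \o (EFin \o k1)) \_ (`]0%R, 1%R] : set R)) \+
  ((abse \o (EFin \o k2)) \_ (`[1%R, +oo[ : set R)))%E.
have ig : (@lebesgue_measure R).-integrable setT g.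
  by apply: integrableD => //; apply: (integrable_mkcond _ _).1 => //;
    exact: integrable_abse.
have igD : (@lebesgue_measure R).-integrable `]0, +oo[ g by exact: integrableS ig.
apply: le_integrable igD => //; first exact/measurable_EFinP.
(* Off its domain a restricted function takes the value [point], which is 0 for extended reals. *)
have p0 : point = 0%E :> \bar R by [].
move=> x; rewrite /= in_itv/= andbT => x0.
  rewrite /g /= !patchE !mem_setE !in_itv/= x0 andbT /=.
  have [x1|x1] := leP x 1; have [x1'|x1'] := leP 1 x.
  + rewrite -EFinD lee_fin ger0_norm ?addr_ge0// ler_wpDr//.
    by rewrite (le_trans (f1 _ _)) ?x0 ?x1 ?ler_norm.
  + rewrite p0 adde0 /= normr_id lee_fin.
    by rewrite (le_trans (f1 _ _)) ?x0 ?x1 ?ler_norm.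
  + by rewrite p0 add0e /= normr_id lee_fin (le_trans (f2 _ _)) ?ler_norm.
  + by have := lt_trans x1 x1'; rewrite ltxx.
Qed.

(** * Bounds and decay of psi and h *)

Section Wavelet.
Context {R : realType} (psi : R -> R) (C delta : R).
Hypothesis psi_derivable : forall x, derivable psi x 1.
Hypothesis psi'_continuous : continuous (derive1 psi).
Hypothesis delta_gt1 : 1 < delta.
Hypothesis psi_decay :
  forall x, `|psi x| + `|x * derive1 psi x| <= C * (jbr x) `^ (- delta).
Local Notation leb := (@lebesgue_measure R).
Local Notation h := (fun x => psi x + x * derive1 psi x).

Lemma is_derive_psi (x : R) : is_derive x 1 psi (derive1 psi x).
Proof. by rewrite derive1E; exact: derivableP. Qed.

Lemma psi_continuous : continuous psi.
Proof.
by move=> x; apply: differentiable_continuous; exact/derivable1_diffP.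
Qed.

Lemma h_continuous : continuous h.
Proof.
move=> x; apply: cvgD; first exact: psi_continuous.
by apply: cvgM; [exact: cvg_id | exact: psi'_continuous].
Qed.

Lemma jbr_ge1 (x : R) : 1 <= jbr x.
Proof. by rewrite -[leLHS]sqrtr1 ler_sqrt ?lerDl ?sqr_ge0// addr_ge0 ?sqr_ge0. Qed.

Lemma jbr_ge_norm (x : R) : `|x| <= jbr x.
Proof. by rewrite -sqrtr_sqr ler_sqrt ?lerDr// addr_ge0 ?sqr_ge0. Qed.

Lemma delta_ge0 : 0 <= delta.
Proof. by rewrite ltW// (lt_trans ltr01). Qed.

Lemma C_ge0 : 0 <= C.
Proof.
have := psi_decay 0; move=> /(le_trans (addr_ge0 (normr_ge0 _) (normr_ge0 _))).
by rewrite pmulr_lge0// powR_gt0// (lt_le_trans _ (jbr_ge1 _)).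
Qed.

(** Since <x> >= 1, its power -delta is at most 1. This uniform bound serves near 0, while
    [psi_decay_powR], from <x> >= |x|, serves in the tails. *)
Lemma psi_decay_bounded x : `|psi x| + `|x * derive1 psi x| <= C.
Proof.
apply: (le_trans (psi_decay x)); rewrite ler_piMr ?C_ge0//.
rewrite powRN invf_le1 ?powR_gt0 ?(lt_le_trans _ (jbr_ge1 _))//.
by rewrite -[leLHS](powRr0 (jbr x)) ler_powR ?jbr_ge1// delta_ge0.
Qed.

Lemma psi_decay_powR x : 0 < x ->
  `|psi x| + `|x * derive1 psi x| <= C * x `^ (- delta).
Proof.
move=> x0; apply: (le_trans (psi_decay x)); apply: ler_wpM2l; first exact: C_ge0.
rewrite !powRN lef_pV2 ?posrE ?powR_gt0 ?(lt_le_trans _ (jbr_ge1 _))//.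
apply: ge0_ler_powR; rewrite ?nnegrE ?(ltW x0) ?delta_ge0//.
  by rewrite (le_trans _ (jbr_ge1 _)).
by rewrite (le_trans (ler_norm _)) ?jbr_ge_norm.
Qed.

Lemma psi_bounded x : `|psi x| <= C.
Proof. by apply: le_trans (psi_decay_bounded x); rewrite lerDl. Qed.

Lemma h_bounded x : `|h x| <= C.
Proof. by apply: le_trans (psi_decay_bounded x); exact: ler_normD. Qed.

Lemma psi_le_powR x : 0 < x -> `|psi x| <= C * x `^ (- delta).
Proof. by move=> x0; apply: le_trans (psi_decay_powR x x0); rewrite lerDl. Qed.

Lemma psi'_le_powR x : 0 < x -> `|x * derive1 psi x| <= C * x `^ (- delta).
Proof. by move=> x0; apply: le_trans (psi_decay_powR x x0); rewrite lerDr. Qed.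

(** The product is at most C v^(p - delta), and p <= 1 < delta makes the exponent negative. The case
    p = 0 is the decay of psi; p = alpha removes the boundary term at infinity in
    [integral_powR_psi]. *)
Lemma powR_psi_cvg0 (p : R) (v : R^nat) : p <= 1 ->
  (forall n, 0 < v n) -> v n @[n --> \oo] --> +oo ->
  v n `^ p * psi (v n) @[n --> \oo] --> 0.
Proof.
move=> p1 v0 vy; apply: norm_cvg0.
have cv : C * v n `^ (p - delta) @[n --> \oo] --> 0.
  rewrite -[X in _ --> X](mulr0 C); apply: cvgMr.
  by apply: powR_lt0_cvg0 => //; have := delta_gt1; lra.
apply: squeeze_cvgr (cvg_cst 0) cv; apply: nearW => n; rewrite normr_ge0/=.
rewrite normrM ger0_norm ?powR_ge0//.
rewrite powRD ?(gt_eqF (v0 n)) ?implybT// mulrCA ler_wpM2l ?powR_ge0//.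
exact: psi_le_powR.
Qed.

Lemma psi_cvg0 (v : R^nat) : (forall n, 0 < v n) -> v n @[n --> \oo] --> +oo ->
  psi (v n) @[n --> \oo] --> 0.
Proof.
move=> v0 vy.
have -> : (fun n => psi (v n)) = (fun n => v n `^ 0 * psi (v n)).
  by apply/funext => n; rewrite powRr0 mul1r.
exact: powR_psi_cvg0.
Qed.

(** * Integrating the rescaled h over all scales above e *)

Lemma is_derive_scaled_psi (u a : R) : 0 < a ->
  is_derive a 1 (fun a : R => - (a^-1 * psi (u * a^-1)))
    (a^-1 * a^-1 * h (u * a^-1)).
Proof.
move=> a0; have a_neq0 : a != 0 by rewrite gt_eqF.
have dV : is_derive a 1 (fun a : R => a^-1) (- a ^- 2).
  have := @is_deriveV R id a 1 1 a_neq0 (is_derive_id _ _).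
  by rewrite /GRing.scale /= mulr1.
have duV : is_derive a 1 (fun a : R => u * a^-1) (u * - a ^- 2).
  exact: (is_deriveZ u dV).
have dpsi := @is_derive1_comp _ psi (fun a : R => u * a^-1) _ _ _ (is_derive_psi _) duV.
(* Differentiating the factor 1 / a yields the psi part of h, and differentiating psi (u / a) yields
   the x psi' part. *)
have dM := is_deriveN (is_deriveM dV dpsi).
apply: (@is_derive_eq _ _ _ _ _ _ _ _ dM).
rewrite /GRing.scale /=; field.
exact: a_neq0.
Qed.

Lemma continuous_scaled_h (u a : R) : 0 < a ->
  {for a, continuous (fun a : R => a^-1 * a^-1 * h (u * a^-1))}.
Proof.
move=> a0; have a_neq0 : a != 0 by rewrite gt_eqF.
have cV : a^-1 @[a --> a] --> a^-1 by apply: cvgV => //; exact: cvg_id.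
apply: cvgM; first exact: cvgM.
apply: (@cvg_comp _ _ _ (fun a : R => u * a^-1) h _ (nbhs (u * a^-1))).
  by apply: cvgM => //; exact: cvg_cst.
exact: h_continuous.
Qed.

Lemma integral_scaled_h (u e : R) : 0 < e ->
  \int[leb]_(a in `[e, +oo[) (a^-1 * a^-1 * h (u * a^-1)) =
  e^-1 * psi (u * e^-1).
Proof.
move=> e0.
have pos x : `[e, +oo[%classic x -> 0 < x.
  by rewrite /= in_itv/= andbT; exact: lt_le_trans.
rewrite -[RHS]opprK -[RHS]sub0r.
have mh : measurable_fun (`[e, +oo[ : set R)
    (fun a : R => a^-1 * a^-1 * h (u * a^-1)).
  by apply: continuous_measurable_on => // x /pos; exact: continuous_scaled_h.
apply: (@Rintegral_primitive _ _ _ (fun a : R => - (a^-1 * psi (u * a^-1)))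
  _ _ _ _ _ (exhausts_itvcy e)) => //.
- by move=> x /pos; exact: continuous_scaled_h.
- by move=> x /pos; exact: is_derive_scaled_psi.
(* As |h| <= C, the integrand is dominated by C a^-2, uniformly in u. *)
- have i2 : leb.-integrable `[e, +oo[ (fun x : R => (C%:E * (x `^ (- 2))%:E)%E).
    by apply: integrableZl => //; apply: integrable_powR_pinfty => //; lra.
  apply: le_integrable i2 => //; first exact/measurable_EFinP.
  move=> x /pos x0 /=; rewrite lee_fin.
  rewrite (_ : x `^ (- 2) = x^-1 * x^-1); last first.
    by rewrite powR_invn ?(ltW x0)// -exprVn expr2.
  have xx0 : 0 <= x^-1 * x^-1 by rewrite mulr_ge0 ?invr_ge0 ?(ltW x0).
  rewrite !(normrM _ (x^-1 * x^-1)) !(normrM (x^-1 * x^-1)) (ger0_norm xx0) (ger0_norm C_ge0).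
  by rewrite mulrC; apply: ler_wpM2r => //; exact: h_bounded.
- exact: cvg_cst.
(* The boundary term at infinity is at most C / a, by boundedness of psi alone, so u = 0 is covered
   as well. *)
- rewrite -[X in _ --> X]oppr0; apply: cvgN; apply: norm_cvg0.
  have cV : C * (e + n.+1%:R)^-1 @[n --> \oo] --> 0.
    rewrite -[X in _ --> X](mulr0 C); apply: cvgMr.
    apply/gtr0_cvgV0; first by apply: nearW => n; rewrite addr_gt0.
    exact: cvg_addn_pinfty.
  apply: squeeze_cvgr (cvg_cst 0) cV; apply: nearW => n; rewrite normr_ge0/=.
  have en : 0 <= (e + n.+1%:R)^-1 by rewrite invr_ge0 addr_ge0// ltW.
  by rewrite normrM (ger0_norm en) mulrC ler_wpM2r// psi_bounded.
Qed.

(** * Averaging over mu: the scale integral of the transform *)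

Variable mu : probability R R.

Lemma measurable_scaled (g : R -> R) (b a : R) : continuous g ->
  measurable_fun setT (fun y : R => g ((b - y) * a)).
Proof.
move=> cg; apply: continuous_measurable_fun => y.
apply: (@cvg_comp _ _ _ (fun y : R => (b - y) * a) g _ (nbhs ((b - y) * a))).
  by apply: cvgM; [apply: cvgB; [exact: cvg_cst | exact: cvg_id] | exact: cvg_cst].
exact: cg.
Qed.

Lemma integrable_scaled (g : R -> R) (b a K : R) : continuous g ->
  (forall x, `|g x| <= K) ->
  mu.-integrable setT (fun y => (g ((b - y) * a))%:E).
Proof.
move=> cg gK; apply: (@le_integrable _ _ _ _ setT _ _ (cst K%:E)) => //.
- by apply/measurable_EFinP; have := @measurable_scaled g b a cg; apply.
- by move=> y _; rewrite lee_fin (le_trans (gK _))// ler_norm.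
- exact: finite_measure_integrable_cst.
Qed.

Lemma wavelet_integral (b e : R) : 0 < e ->
  \int[leb]_(a in `[e, +oo[) (cwt h mu b a / a) =
  e^-1 * \int[mu]_y psi ((b - y) * e^-1).
Proof.
move=> e0.
have pos x : `[e, +oo[%classic x -> 0 < x.
  by rewrite /= in_itv/= andbT; exact: lt_le_trans.
(* [a `^ (- 1)] stands for [a^-1] since only [powR] is known to be measurable. *)
pose f (y a : R) := a `^ (- 1) * a `^ (- 1) * h ((b - y) * a `^ (- 1)).
have ih := integrable_scaled h b _ C h_continuous h_bounded.
have ip := integrable_scaled psi b e^-1 C psi_continuous psi_bounded.
transitivity (\int[leb]_(a in `[e, +oo[) \int[mu]_y f y a).
  apply: eq_Rintegral => a /set_mem /pos a0.
  rewrite /cwt /f powR_inv1 ?ltW// RintegralZl//; last exact: ih.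
  by rewrite mulrAC.
transitivity (\int[mu]_y (e^-1 * psi ((b - y) * e^-1))); last by rewrite RintegralZl.
(* The majorant C a^-2 is independent of y and integrable because the scales stay above e > 0. *)
rewrite -(@Rintegral_Fubini_dominated _ _ _ _ _ mu leb _ f (fun a => C * a `^ (- 2))).
- apply: eq_Rintegral => y _; rewrite -(integral_scaled_h (b - y) e e0).
  by apply: eq_Rintegral => a /set_mem /pos a0; rewrite /f powR_inv1 ?ltW.
- by [].
- have m1 : measurable_fun setT (fun z : R * R => z.2 `^ (- 1)).
    by apply: (measurableT_comp (measurable_powR (-1))); exact: measurable_snd.
  apply: measurable_funM; first exact: measurable_funM.
  apply: (measurableT_comp (continuous_measurable_fun h_continuous)).
  apply: measurable_funM => //; apply: measurable_funB => //.
- have := @integrable_powR_pinfty _ e (- 2) e0.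
  move=> /(_ _)/(integrableZl _) -/(_ _ C) ; apply => //; lra.
- move=> y a /pos a0; rewrite /f normrM mulrC.
  rewrite (_ : a `^ (- 2) = a `^ (- 1) * a `^ (- 1)); last first.
    by rewrite powR_invn ?powR_inv1 ?(ltW a0)// -exprVn expr2.
  rewrite (ger0_norm (mulr_ge0 (powR_ge0 _ _) (powR_ge0 _ _))).
  by apply: ler_wpM2r; [rewrite mulr_ge0 ?powR_ge0 | exact: h_bounded].
Qed.

(** * Concentration at an atom *)

Hypothesis psi_even : forall x, psi (- x) = psi x.

Lemma psi_normr (x : R) : psi `|x| = psi x.
Proof. by case: (ger0P x) => // _; exact: psi_even. Qed.

Lemma cvgV_pinfty (e : R^nat) : (forall n, 0 < e n) ->
  e n @[n --> \oo] --> 0 -> (e n)^-1 @[n --> \oo] --> +oo.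
Proof.
move=> e0 ecvg; apply/gtr0_cvgV0; first by apply: nearW => n; rewrite invr_gt0.
by under [X in X @ _]eq_fun do rewrite invrK.
Qed.

(** The integrand tends to the indicator of {b}: it equals psi 0 = 1 at y = b, and elsewhere |b - y|
    / e tends to infinity. The constant [C] is an integrable majorant for a probability. *)
Lemma psi_concentration (b : R) : psi 0 = 1 ->
  \int[mu]_y psi ((b - y) * e^-1) @[e --> 0^'+] --> fine (mu [set b]).
Proof.
move=> psi0; apply/cvg_at_rightP => e [e0 ecvg].
have -> : fine (mu [set b]) = \int[mu]_y (\1_[set b] y).
  by rewrite /Rintegral integral_indic// setIT.
apply: (@Rintegral_dominated_cvg _ _ _ mu setT _ _ (cst C)) => //.
- by move=> n; have := @measurable_scaled psi b (e n)^-1 psi_continuous; apply.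
- move=> y _; rewrite indicE; have [->|yb] := eqVneq y b.
    rewrite mem_set//; under eq_fun do rewrite subrr mul0r psi0.
    exact: cvg_cst.
  rewrite memNset; last by apply/eqP.
  have by0 : 0 < `|b - y| by rewrite normr_gt0 subr_eq0 eq_sym.
  have pos n : 0 < `|b - y| * (e n)^-1 by rewrite mulr_gt0// invr_gt0.
  (* Evenness makes the arguments positive, as [psi_cvg0] requires. *)
  have -> : (fun n => psi ((b - y) * (e n)^-1)) =
      (fun n => psi (`|b - y| * (e n)^-1)).
    apply/funext => n; rewrite -[LHS]psi_normr normrM.
    by rewrite (@ger0_norm _ (e n)^-1)// invr_ge0 ltW.
  apply: psi_cvg0 => //.
  apply: (@cvg_comp _ _ _ (fun n => (e n)^-1) (fun r => `|b - y| * r) _ +oo).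
    exact: cvgV_pinfty.
  exact: (gt0_cvgMry by0 cvg_id).
- exact: finite_measure_integrable_cst.
- by move=> n y _; exact: psi_bounded.
Qed.

(** * Integrability of psi and psi' against powers on the half-line *)

Lemma psi'_le_tail (x : R) : 1 <= x -> `|derive1 psi x| <= C * x `^ (- delta).
Proof.
move=> x1; have x0 : 0 < x by exact: lt_le_trans x1.
apply: le_trans (psi'_le_powR x x0); rewrite normrM ler_peMl//.
by rewrite (le_trans x1) ?ler_norm.
Qed.

Lemma integrable_psi'_seg :
  leb.-integrable `]0, 1] (EFin \o (fun x => `|derive1 psi x|)).
Proof.
apply: (@integrableS _ _ _ leb `[0, 1]) => //; first exact: subset_itv_oc_cc.
apply: continuous_compact_integrable; first exact: segment_compact.
apply: continuous_subspaceT => x; apply: cvg_norm; exact: psi'_continuous.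
Qed.

Lemma integrable_tail : leb.-integrable `[1, +oo[ (EFin \o (fun x : R => C * x `^ (- delta))).
Proof.
rewrite (_ : EFin \o _ = (fun x : R => (C%:E * (x `^ (- delta))%:E)%E)); last first.
  by apply/funext => x; rewrite /= EFinM.
apply: integrableZl => //; apply: integrable_powR_pinfty => //.
by rewrite ltrN2.
Qed.

Lemma integrable_psi' : leb.-integrable `]0, +oo[ (EFin \o derive1 psi).
Proof.
apply: (integrable_itv0y _ _ _ _ integrable_psi'_seg integrable_tail) => //.
- exact: measurable_funTS (continuous_measurable_fun psi'_continuous).
- exact: psi'_le_tail.
Qed.

(** On ]0, 1] the weight x^a is at most 1; beyond 1 it is at most x, because a <= 1, and the decay
    of x psi' takes over. *)
Lemma integrable_powR_psi' (a : R) : 0 < a <= 1 ->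
  leb.-integrable `]0, +oo[ (EFin \o (fun x => x `^ a * derive1 psi x)).
Proof.
move=> /andP[a0 a1].
apply: (integrable_itv0y _ _ _ _ integrable_psi'_seg integrable_tail).
- apply: measurable_funTS; apply: measurable_funM; first exact: measurable_powR.
  exact: continuous_measurable_fun.
- move=> x /andP[x0 x1]; rewrite normrM ger0_norm ?powR_ge0// ler_piMl//.
  have : x `^ a <= 1 `^ a by rewrite ge0_ler_powR ?nnegrE ?(ltW x0) ?(ltW a0) ?ler01.
  by rewrite powR1.
- move=> x x1; have x0 : 0 < x by exact: lt_le_trans x1.
  apply: le_trans (psi'_le_powR x x0); rewrite !normrM ler_wpM2r//.
  by rewrite !ger0_norm ?powR_ge0 ?(ltW x0)// ler1_powR.
Qed.

(** Near 0, psi is bounded and a > 0 makes x^(a - 1) integrable; beyond 1, a <= 1 makes the weight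
    at most 1 and psi decays like x^(-delta). *)
Lemma integrable_powR_psi (a : R) : 0 < a <= 1 ->
  leb.-integrable `]0, +oo[ (EFin \o (fun x => x `^ (a - 1) * psi x)).
Proof.
move=> /andP[a0 a1].
apply: (integrable_itv0y _ (fun x => C * x `^ (a - 1)) _ _ _ integrable_tail).
- apply: measurable_funTS; apply: measurable_funM; first exact: measurable_powR.
  exact: continuous_measurable_fun psi_continuous.
- rewrite (_ : EFin \o _ = (fun x : R => (C%:E * (x `^ (a - 1))%:E)%E)); last first.
    by apply/funext => x; rewrite /= EFinM.
  by apply: integrableZl => //; apply: integrable_powR01; lra.
- move=> x /andP[x0 x1]; rewrite normrM ger0_norm ?powR_ge0// mulrC.
  by rewrite ler_wpM2r ?powR_ge0 ?psi_bounded.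
- move=> x x1; have x0 : 0 < x by exact: lt_le_trans x1.
  apply: le_trans (psi_le_powR x x0); rewrite normrM ger0_norm ?powR_ge0//.
  by rewrite ler_piMl// -[leRHS](powRr0 x) ler_powR// subr_le0.
Qed.

(** The primitive psi vanishes at infinity. The end x is left out to match the strict inequality
    defining the open intervals of [dalpha_is]. *)
Lemma integral_psi'_tail (x : R) : 0 <= x ->
  \int[leb]_(s in `]x, +oo[) derive1 psi s = - psi x.
Proof.
move=> x0; rewrite -sub0r.
apply: (@Rintegral_primitive _ _ _ psi _ _ _ _ _ (exhausts_itvoy x)) => //.
- by move=> y _; exact: psi'_continuous.
- by move=> y _; exact: is_derive_psi.
- apply: integrableS integrable_psi' => //.
  by apply: subset_itvr; rewrite bnd_simp.
- by apply: (@cvg_comp _ _ _ _ psi _ (nbhs x));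
    [exact: cvg_addn_inv | exact: psi_continuous].
- apply: psi_cvg0; first by move=> n; rewrite ltr_wpDl.
  exact: cvg_addn_pinfty.
Qed.

(** * Masses of centred intervals and the layer-cake formula *)

Definition interval_mass (b r : R) : R := fine (mu [set` `]b - r, b + r[]).
Local Notation M := interval_mass.

Lemma interval_mass_ge0 (b r : R) : 0 <= M b r.
Proof. exact/fine_ge0/measure_ge0. Qed.

Lemma interval_mass_le1 (b r : R) : M b r <= 1.
Proof.
by rewrite -lee_fin fineK ?probability_le1//; exact: fin_num_measure.
Qed.

Lemma interval_mass_nondecreasing (b : R) : nondecreasing_fun (M b).
Proof.
move=> r s rs; apply: fine_le; rewrite ?fin_num_measure//.
apply: le_measure; rewrite ?inE//.
by apply: subset_itv; rewrite bnd_simp; lra.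
Qed.

(** After [integral_psi'_tail] at |b - y| / e, the order of integration is exchanged with majorant
    |psi'|. For fixed s, the y with |b - y| < e s form the interval of radius e s about b. *)
Lemma psi_layer_cake (b e : R) : 0 < e ->
  \int[mu]_y psi ((b - y) * e^-1) =
  - \int[leb]_(s in `]0, +oo[) (derive1 psi s * M b (e * s)).
Proof.
move=> e0; apply/eqP; rewrite -eqr_oppLR; apply/eqP.
pose f (y s : R) := if `|b - y| < e * s then derive1 psi s else 0.
have ip := integrable_scaled psi b e^-1 C psi_continuous psi_bounded.
transitivity (\int[mu]_y \int[leb]_(s in `]0, +oo[) f y s).
  rewrite -mulN1r -RintegralZl//; apply: eq_Rintegral => y _.
  have by0 : 0 <= `|b - y| * e^-1 by rewrite mulr_ge0// invr_ge0 ltW.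
  have -> : psi ((b - y) * e^-1) = psi (`|b - y| * e^-1).
    by rewrite -[LHS]psi_normr normrM (@ger0_norm _ e^-1)// invr_ge0 ltW.
  rewrite mulN1r -(integral_psi'_tail _ by0).
  rewrite [LHS]Rintegral_mkcond [RHS]Rintegral_mkcond.
  apply: eq_Rintegral => s _; rewrite !patchE !mem_setE !in_itv/= !andbT /f.
  rewrite ltr_pdivrMr// (mulrC s).
  (* For s <= 0 the condition |b - y| < e s fails, so integrating over the positive half-line loses
     nothing. *)
  have [s0|s0] := ltP 0 s; first by case: ifP.
  case: ifPn => // /(le_lt_trans (normr_ge0 _)).
  by rewrite pmulr_rgt0// ltNge s0.
rewrite (@Rintegral_Fubini_dominated _ _ _ _ _ mu leb _ f (fun s => `|derive1 psi s|)).
- apply: eq_Rintegral => s _.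
  have -> : M b (e * s) = \int[mu]_y \1_(`]b - e * s, b + e * s[) y.
    by rewrite /M /Rintegral integral_indic// setIT.
  rewrite -RintegralZl//; last exact: integrable_indic.
  apply: eq_Rintegral => y _; rewrite /f indicE mem_setE in_itv/=.
  by rewrite ltr_distlC; case: ifP => _; rewrite ?mulr1 ?mulr0.
- by [].
- apply: measurable_fun_ifT.
  + apply: measurable_fun_ltr; last by apply: measurable_funM.
    by apply: measurableT_comp => //; exact: measurable_funB.
  + apply: (measurableT_comp (continuous_measurable_fun psi'_continuous)).
    exact: measurable_snd.
  + exact: measurable_cst.
- exact: (integrable_norm integrable_psi').
- by move=> y s _; rewrite /f; case: ifP => // _; rewrite normr0.
Qed.

(** Integration by parts: the two integrands add up to the derivative of 2^a y^a psi y, which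
    vanishes at 0 because a > 0 and at infinity because a <= 1 < delta. *)
Lemma integral_powR_psi (a : R) : 0 < a <= 1 ->
  \int[leb]_(y in `]0, +oo[) (a * 2 `^ a * y `^ (a - 1) * psi y) =
  - \int[leb]_(y in `]0, +oo[) (derive1 psi y * (2 * y) `^ a).
Proof.
move=> a01; have /andP[a0 a1] := a01; apply/eqP; rewrite -addr_eq0; apply/eqP.
pose f1 (y : R) := a * 2 `^ a * y `^ (a - 1) * psi y.
pose f2 (y : R) := derive1 psi y * (2 * y) `^ a.
have pos (y : R) : `]0, +oo[%classic y -> 0 < y by rewrite /= in_itv/= andbT.
have f2E (y : R) : `]0, +oo[%classic y -> f2 y = 2 `^ a * (y `^ a * derive1 psi y).
  by move=> /pos y0; rewrite /f2 powRM ?(ltW y0)// mulrC mulrA.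
have i1 : leb.-integrable `]0, +oo[ (EFin \o f1).
  rewrite (_ : EFin \o f1 = fun y => ((a * 2 `^ a)%:E * (y `^ (a - 1) * psi y)%:E)%E).
    by apply: integrableZl => //; exact: integrable_powR_psi.
  by apply/funext => y; rewrite /f1 /= -mulrA.
have i2 : leb.-integrable `]0, +oo[ (EFin \o f2).
  apply: (@eq_integrable _ _ _ leb _ _
    (fun y => ((2 `^ a)%:E * (y `^ a * derive1 psi y)%:E)%E)) => //.
    by move=> y /set_mem yD; rewrite /= f2E.
  by apply: integrableZl => //; exact: integrable_powR_psi'.
rewrite -RintegralD// -[RHS](subr0 0).
pose F (y : R) := 2 `^ a * (y `^ a * psi y).
apply: (@Rintegral_primitive _ _ _ F _ _ _ _ _ (exhausts_itvoy 0)) => //.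
- move=> y /pos y0; apply: cvgD.
    apply: cvgM; last exact: psi_continuous.
    by apply: cvgM; [exact: cvg_cst | exact: continuous_powR_pos].
  apply: cvgM; first exact: psi'_continuous.
  apply: (@cvg_comp _ _ _ (fun y => 2 * y) (@powR R ^~ a) _ (nbhs (2 * y))).
    by apply: cvgM; [exact: cvg_cst | exact: cvg_id].
  by apply: continuous_powR_pos; rewrite mulr_gt0.
- move=> y yD; have y0 := pos _ yD.
  have dM := is_deriveZ (2 `^ a) (is_deriveM (is_derive1_powR a y0) (is_derive_psi y)).
  apply: (@is_derive_eq _ _ _ _ _ _ _ _ dM).
  rewrite -/(f1 y) -/(f2 y) f2E// /f1 /GRing.scale /=; ring.
- exact: (integrableD _ i1 i2).
- rewrite -[X in _ --> X](mulr0 (2 `^ a)); apply: cvgMr.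
  rewrite -[X in _ --> X](mul0r (psi 0)); apply: cvgM.
    have /cvg_at_rightP : x `^ a @[x --> (0:R)^'+] --> 0 by exact: powR_cvg0.
    apply; split=> [n|]; first by rewrite add0r invr_gt0.
    exact: cvg_addn_inv.
  by apply: (@cvg_comp _ _ _ _ psi _ (nbhs 0));
    [exact: cvg_addn_inv | exact: psi_continuous].
- rewrite -[X in _ --> X](mulr0 (2 `^ a)); apply: cvgMr.
  by apply: powR_psi_cvg0 => //; exact: cvg_addn_pinfty.
Qed.

(** * The scaled limit governed by the alpha-derivative *)

Lemma interval_mass_le_powR (b a L : R) : 0 < a -> dalpha_is mu a b L ->
  exists K, forall r, 0 < r -> M b r <= K * (2 * r) `^ a.
Proof.
move=> a0 /cvgrPdist_le /(_ 1 ltr01) [r0 /= r00 near0].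
have r2 : 0 < (2 * (r0 / 2)) `^ a by rewrite powR_gt0// mulr_gt0// divr_gt0.
(* For r < r0 / 2 the quotient is within 1 of L, hence at most |L| + 1. For larger r the mass is at
   most 1 and (2 r)^a is at least its value at r0 / 2. All radii matter, since s runs over a
   half-line. *)
exists (Num.max (`|L| + 1) ((2 * (r0 / 2)) `^ a)^-1) => r rpos.
have p2 : 0 < (2 * r) `^ a by rewrite powR_gt0// mulr_gt0.
have [rr0|r0r] := ltP r (r0 / 2); last first.
  apply: (le_trans (interval_mass_le1 _ _)).
  apply: (@le_trans _ _ (((2 * (r0 / 2)) `^ a)^-1 * (2 * r) `^ a)).
    rewrite mulrC ler_pdivlMr// mul1r ge0_ler_powR ?nnegrE ?(ltW a0)//.
    - by rewrite mulr_ge0// divr_ge0// ltW.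
    - by rewrite mulr_ge0// ltW.
    - by rewrite ler_pM2l.
  by rewrite ler_wpM2r ?(ltW p2)// le_max lexx orbT.
rewrite -ler_pdivrMr// le_max; apply/orP; left.
have : `|L - M b r / (2 * r) `^ a| <= 1.
  apply: near0 => //=; rewrite sub0r normrN gtr0_norm//.
  by rewrite (lt_le_trans rr0)//; lra.
move=> /ler_normlP[+ _]; have := ler_norm L; lra.
Qed.

Lemma psi_scaled_limit (b a L : R) : 0 < a <= 1 -> dalpha_is mu a b L ->
  e `^ (- a) * \int[mu]_y psi ((b - y) * e^-1) @[e --> 0^'+] -->
  \int[leb]_(y in `]0, +oo[) (a * 2 `^ a * y `^ (a - 1) * psi y) * L.
Proof.
move=> a01 dL; have /andP[a0 a1] := a01.
have [K MK] := interval_mass_le_powR _ _ _ a0 dL.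
apply/cvg_at_rightP => e [e0 ecvg].
have pos (s : R) : `]0, +oo[%classic s -> 0 < s by rewrite /= in_itv/= andbT.
(* Homogeneity: the prefactor e^(-a) is exactly what turns (2 e s)^a into (2 s)^a. *)
have eE n (s : R) : 0 < s -> (e n) `^ (- a) * (2 * (e n * s)) `^ a = (2 * s) `^ a.
  move=> s0; rewrite mulrCA (@powRM _ (e n)) ?mulr_ge0 ?(ltW s0) ?(ltW (e0 n))//.
  by rewrite powRN mulKf// gt_eqF// powR_gt0.
rewrite integral_powR_psi// mulNr.
pose f n (s : R) := (e n) `^ (- a) * (derive1 psi s * M b (e n * s)).
have mM n : measurable_fun setT (fun s => M b (e n * s)).
  (* The mass is monotone in the radius, hence measurable in s. *)
  apply: nondecreasing_measurable => // s t st.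
  by apply: interval_mass_nondecreasing; rewrite ler_pM2l.
have mf n : measurable_fun (`]0, +oo[ : set R) (f n).
  apply: measurable_funTS; apply: measurable_funM => //.
  apply: measurable_funM => //; exact: continuous_measurable_fun.
have iM n : leb.-integrable `]0, +oo[
    (EFin \o (fun s => derive1 psi s * M b (e n * s))).
  apply: le_integrable integrable_psi' => //.
    apply/measurable_EFinP; apply: measurable_funTS; apply: measurable_funM.
      exact: continuous_measurable_fun.
    exact: mM.
  move=> s _; rewrite lee_fin normrM ler_piMr// ger0_norm ?interval_mass_ge0//.
  exact: interval_mass_le1.
have -> : (fun n => e n `^ (- a) * \int[mu]_y psi ((b - y) * (e n)^-1)) =
    (fun n => - \int[leb]_(s in `]0, +oo[) f n s).
  by apply/funext => n; rewrite psi_layer_cake// mulrN RintegralZl.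
have ig : leb.-integrable `]0, +oo[
    (EFin \o (fun s => 2 `^ a * (s `^ a * derive1 psi s))).
  by have /(integrableZl _ (2 `^ a)) := integrable_powR_psi' a a01; apply.
have gE : {in (`]0, +oo[%classic : set R), (fun s => 2 `^ a * (s `^ a * derive1 psi s)) =1
    (fun s => derive1 psi s * (2 * s) `^ a)}.
  by move=> s /set_mem /pos s0; rewrite /= powRM ?(ltW s0)// mulrA mulrC.
have ig' : leb.-integrable `]0, +oo[
    (EFin \o (fun s => derive1 psi s * (2 * s) `^ a)).
  apply: (@eq_integrable _ _ _ leb _ _ _ _ _ ig) => //.
  by move=> s /gE /= ->.
rewrite -RintegralZr//.
apply: cvgN.
apply: (@Rintegral_dominated_cvg _ _ _ leb _ f _
  (fun s => `|K * (2 `^ a * (s `^ a * derive1 psi s))|)) => //.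
- move=> s /pos s0.
  (* For fixed s the last factor is the quotient of [dalpha_is] at the radius e s, which tends to 0
     from the right, so it tends to L. *)
  have -> : f^~ s = fun n => derive1 psi s * (2 * s) `^ a *
      (M b (e n * s) / (2 * (e n * s)) `^ a).
    apply/funext => n; rewrite -(eE n)// /f; field.
    by rewrite gt_eqF// powR_gt0// !mulr_gt0.
  apply: cvgMr.
  have /cvg_at_rightP := dL; apply; split=> [n|]; first by rewrite mulr_gt0.
  rewrite -[X in _ --> X](mul0r s); apply: cvgM => //; exact: cvg_cst.
- apply: integrable_norm.
  by have /(integrableZl _ K) := ig; apply.
- move=> n s /pos s0.
  have en0 : 0 <= e n `^ (- a) by exact: powR_ge0.
  rewrite /f [in leLHS]normrM (ger0_norm en0) normrM (ger0_norm (interval_mass_ge0 _ _)).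
  (* The global bound on the mass, combined with [eE], gives a majorant free of n. *)
  have MKn := MK (e n * s) (mulr_gt0 (e0 n) s0).
  apply: (@le_trans _ _ (e n `^ (- a) * (`|derive1 psi s| * (K * (2 * (e n * s)) `^ a)))).
    by apply: ler_wpM2l => //; exact: ler_wpM2l.
  rewrite [leLHS](_ : _ = `|derive1 psi s| * K * (2 * s) `^ a); last first.
    by rewrite -(eE n s s0); ring.
  rewrite powRM ?(ltW s0)// !normrM !(ger0_norm (powR_ge0 _ _)).
  rewrite [leLHS](_ : _ = K * (2 `^ a * (s `^ a * `|derive1 psi s|))); last by ring.
  by apply: ler_wpM2r; [rewrite !mulr_ge0 ?powR_ge0 | exact: ler_norm].
Qed.

End Wavelet.

(** * The two limits for the wavelet transform *)

Theorem theorem2p6 (R : realType) (psi : R -> R) (mu : probability R R) :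
  (forall x, derivable psi x 1) ->
  continuous (derive1 psi) ->
  psi 0 = 1 ->
  (forall x, psi (- x) = psi x) ->
  (exists (C delta : R), 0 < C /\ 1 < delta /\
     forall x, `|psi x| + `|x * derive1 psi x| <= C * (jbr x) `^ (- delta)) ->
  Rintegral lebesgue_measure setT psi != 0 ->
  let h := fun x => psi x + x * derive1 psi x in
  forall b : R,
    ((fun eps : R =>
        eps * Rintegral lebesgue_measure [set` `[eps, +oo[]
                (fun a => cwt h mu b a / a)) @ 0^'+
       --> fine (mu [set b]))
    /\
    (forall alpha L : R, 0 < alpha <= 1 -> dalpha_is mu alpha b L ->
      (fun eps : R =>
         eps `^ (1 - alpha) * Rintegral lebesgue_measure [set` `[eps, +oo[]
                (fun a => cwt h mu b a / a)) @ 0^'+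
       --> Rintegral lebesgue_measure [set` `]0, +oo[]
              (fun y => alpha * 2 `^ alpha * y `^ (alpha - 1) * psi y) * L).
Proof.
move=> dpsi cpsi' psi0 psi_even [C [delta [_ [delta1 decay]]]] _ h b.
have W := @wavelet_integral R psi C delta dpsi cpsi' delta1 decay mu b.
split=> [|alpha L alpha01 dL].
- apply: cvg_trans (@psi_concentration R psi C delta dpsi delta1 decay mu psi_even b psi0).
  apply: near_eq_cvg; near=> e; have e0 : 0 < e by near: e; exact: nbhs_right_gt.
  by rewrite W// mulrA divff ?mul1r// gt_eqF.
- apply: cvg_trans (@psi_scaled_limit R psi C delta dpsi cpsi' delta1 decay mu
    psi_even b alpha L alpha01 dL).
  apply: near_eq_cvg; near=> e; have e0 : 0 < e by near: e; exact: nbhs_right_gt.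
  rewrite W// mulrA; congr (_ * _).
  (* Splitting e^(1 - alpha) as e^(-alpha) times e, the factor e cancels the e^-1 of
     [wavelet_integral]. *)
  rewrite addrC powRD ?(gt_eqF e0) ?implybT//.
  by rewrite powRr1 ?(ltW e0)// mulfK// gt_eqF.
Unshelve. all: by end_near. Qed.
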